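(* Let $a,b\in\mathbb{C}$ with $|ab|<1$ and let $x\in\mathbb{C}$. The following functional equations hold for the discrete Fourier transform (DFT) of size $2$: (1) $2f_{(0,0,2)}(a,b,x)+f_{(\frac12,0,2)}(a,b,x)+f_{(\frac{-1}{2},0,2)}(a,b,x)=2f_{(0,0,1)}\left(a^{1/4},b^{1/4},x/2\right)$; (2) $2f_{(0,0,2)}(a,b,x)-\left[f_{(\frac12,0,2)}(a,b,x)+f_{(\frac{-1}{2},0,2)}(a,b,x)\right]=f_{(0,\frac12,1)}\left(a^{1/4},b^{1/4},x/2\right)+f_{(0,\frac{-1}{2},1)}\left(a^{1/4},b^{1/4},x/2\right)$.
   Context: The Ramanujan theta function with characteristics $(\alpha,\beta,c)$ is $$f_{(\alpha,\beta,c)}(a,b,x)=\sum_{m\in\mathbb{Z}}a^{\frac{(m+\alpha)(m+\alpha+1/c)}{2}}\,b^{\frac{(m+\alpha)(m+\alpha-1/c)}{2}}\,e^{2\pi i(m+\alpha)(x+\beta)}.$$ No particular branch is specified for the fractional powers of $a$ and $b$. The DFT of size $2$ is the $2\times2$ matrix with entries $\frac{1}{\sqrt2}e^{2\pi i jl/2}$, $j,l\in\{0,1\}$; the phrase ''for the DFT of size $2$'' indicates that the identities arise from its eigenvectors, and the identities themselves involve only the functions $f_{(\alpha,\beta,c)}$. *)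

(* Defs.v *)
From Stdlib Require Import Reals ZArith.
From Coquelicot Require Import Coquelicot.

Open Scope R_scope.

Definition Cexp (z : C) : C :=
  (exp (Re z) * cos (Im z), exp (Re z) * sin (Im z)).

(* No continuity is asked of L: it chooses one logarithm of each nonzero
   complex number, so quantifying over L covers every determination of the
   fractional powers (the principal one in particular). *)
Definition log_branch (L : C -> C) : Prop :=
  forall z : C, z <> RtoC 0 -> Cexp (L z) = z.

(* z^s for a real exponent s, with respect to the logarithm L; at z = 0 the
   convention is 0^0 = 1 and 0^s = 0 for s <> 0. *)
Definition cpow (L : C -> C) (z : C) (s : R) : C :=
  if Ceq_dec z (RtoC 0)
  then (if Req_EM_T s 0 then RtoC 1 else RtoC 0)
  else Cexp (Cmult (RtoC s) (L z)).

(* Like Series, this is total and meaningful for convergent series only. *)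
Definition CSeries (u : nat -> C) : C :=
  (Series (fun n => Re (u n)), Series (fun n => Im (u n))).

Lemma CSeries_unique (u : nat -> C) (l : C) :
  @is_series C_AbsRing C_NormedModule u l -> CSeries u = l.
Proof.
intros H.
assert (Hre : forall n, sum_n (fun k => Re (u k)) n = Re (@sum_n C_AbelianMonoid u n)).
{ induction n as [|n IH]; [now rewrite !sum_O|now rewrite !sum_Sn, IH]. }
assert (Him : forall n, sum_n (fun k => Im (u k)) n = Im (@sum_n C_AbelianMonoid u n)).
{ induction n as [|n IH]; [now rewrite !sum_O|now rewrite !sum_Sn, IH]. }
unfold CSeries; rewrite (surjective_pairing l); f_equal; apply is_series_unique.
- apply filterlim_ext with (fun n => Re (@sum_n C_AbelianMonoid u n)).
  { intros n; symmetry; apply Hre. }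
  intros P [e He]. apply (H (fun z => P (fst z))). exists e.
  intros y [Hy _]. now apply He.
- apply filterlim_ext with (fun n => Im (@sum_n C_AbelianMonoid u n)).
  { intros n; symmetry; apply Him. }
  intros P [e He]. apply (H (fun z => P (snd z))). exists e.
  intros y [_ Hy]. now apply He.
Qed.

Definition CSeriesZ (u : Z -> C) : C :=
  Cplus (CSeries (fun n => u (Z.of_nat n)))
        (CSeries (fun n => u (- Z.of_nat (S n))%Z)).

(* La and Lb are the logarithms defining the powers of a and of b. *)
Definition theta (La Lb : C -> C) (alpha beta c : R) (a b x : C) : C :=
  CSeriesZ (fun m : Z =>
    let t := IZR m + alpha in
    Cmult (Cmult (cpow La a (t * (t + 1 / c) / 2))
                 (cpow Lb b (t * (t - 1 / c) / 2)))
          (Cexp (Cmult (Cmult (RtoC (2 * PI)) Ci)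
                       (Cmult (RtoC t) (Cplus x (RtoC beta)))))).

(* Main.v *)
(** Put [g n = a^(n(n+1)/8) b^(n(n-1)/8) exp(pi i n x)] for an integer [n].
    Substituting [n = 2m], [2m+1], [2m-1] turns the three series on the left
    into sums of [g] over the even integers and (twice) over the odd integers.
    On the right, [a^(1/4)] and [b^(1/4)] only occur with the integral exponents
    [n(n+1)/2] and [n(n-1)/2], so the choice of logarithm does not matter there,
    and the series are the sums of [g n], respectively of [(-1)^n g n], over all
    integers.  Both identities are the splitting of an absolutely convergent
    series over the integers according to parity. *)

Require Import Defs.
From Stdlib Require Import Reals ZArith Lra Lia.
From Coquelicot Require Import Coquelicot.

Open Scope R_scope.

(** * The complex exponential and its values at multiples of pi i *)

Lemma Cexp_plus (z w : C) : Cexp (z + w)%C = (Cexp z * Cexp w)%C.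
Proof.
destruct z as [x y], w as [u v]; unfold Cexp, Cmult; simpl.
rewrite exp_plus, cos_plus, sin_plus; f_equal; ring.
Qed.

Lemma Cexp_0 : Cexp (RtoC 0) = RtoC 1.
Proof.
unfold Cexp; simpl; rewrite exp_0, cos_0, sin_0; unfold RtoC; f_equal; ring.
Qed.

Lemma Cmod_Cexp (z : C) : Cmod (Cexp z) = exp (Re z).
Proof.
unfold Cmod, Cexp; cbn [fst snd].
replace (_ + _) with (exp (Re z) ^ 2).
- apply sqrt_pow2, Rlt_le, exp_pos.
- pose proof (sin2_cos2 (Im z)) as H; unfold Rsqr in H.
  transitivity (exp (Re z) ^ 2 * (sin (Im z) * sin (Im z) + cos (Im z) * cos (Im z)));
    [rewrite H|]; ring.
Qed.

Lemma Cexp_neq_0 (z : C) : Cexp z <> RtoC 0.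
Proof.
intros H; pose proof (Cmod_Cexp z) as E.
rewrite H, Cmod_0 in E; pose proof (exp_pos (Re z)); lra.
Qed.

(** [Cexp (k * z)] is the [k]-th power of [Cexp z]. This is what lets one logarithm be exchanged for
    another under a natural exponent. *)
Lemma Cexp_INR_ext (z w : C) (k : nat) :
  Cexp z = Cexp w -> Cexp (RtoC (INR k) * z)%C = Cexp (RtoC (INR k) * w)%C.
Proof.
intros H; induction k as [|k IH].
- simpl; now rewrite !Cmult_0_l.
- rewrite S_INR, RtoC_plus, !Cmult_plus_distr_r, !Cmult_1_l, !Cexp_plus.
  now rewrite IH, H.
Qed.

Lemma Cexp_PI_nat (k : nat) :
  Cexp (RtoC (INR k) * (RtoC PI * Ci))%C = RtoC ((-1) ^ k).
Proof.
induction k as [|k IH].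
- simpl; rewrite Cmult_0_l; apply Cexp_0.
- rewrite S_INR, RtoC_plus, Cmult_plus_distr_r, Cmult_1_l, Cexp_plus, IH.
  replace (Cexp (RtoC PI * Ci)%C) with (RtoC (-1)).
  + rewrite <- RtoC_mult; f_equal; simpl; ring.
  + unfold Cexp, Cmult, RtoC, Ci; simpl.
    replace (PI * 0 - 0 * 1) with 0 by ring.
    replace (PI * 1 + 0 * 0) with PI by ring.
    rewrite exp_0, cos_PI, sin_PI; f_equal; ring.
Qed.

Lemma Cexp_2PI_int (k : Z) :
  Cexp (RtoC (IZR k) * (RtoC (2 * PI) * Ci))%C = RtoC 1.
Proof.
assert (Hnat : forall n : nat, Cexp (RtoC (INR n) * (RtoC (2 * PI) * Ci))%C = RtoC 1).
{ intros n.
  replace (RtoC (INR n) * (RtoC (2 * PI) * Ci))%C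
    with (RtoC (INR (2 * n)) * (RtoC PI * Ci))%C.
  - now rewrite Cexp_PI_nat, pow_1_even.
  - rewrite mult_INR, !RtoC_mult; change (INR 2) with 2; ring. }
destruct (Z_le_gt_dec 0 k) as [Hk|Hk].
- rewrite <- (Z2Nat.id k Hk), <- INR_IZR_INZ; apply Hnat.
(* For negative [k], multiply by the factor for [- k], equal to 1 by the natural case; the exponents
   cancel. *)
- rewrite <- (Cmult_1_r (Cexp _)).
  rewrite <- (Hnat (Z.to_nat (- k))) at 1; rewrite <- Cexp_plus.
  rewrite INR_IZR_INZ, Z2Nat.id, <- Cmult_plus_distr_r, <- RtoC_plus, <- plus_IZR by lia.
  replace (k + - k)%Z with 0%Z by lia.
  rewrite Cmult_0_l; apply Cexp_0.
Qed.

Lemma Cexp_PI_even (m : Z) :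
  Cexp (RtoC (IZR (2 * m)) * (RtoC PI * Ci))%C = RtoC 1.
Proof.
rewrite <- (Cexp_2PI_int m), mult_IZR, !RtoC_mult; f_equal; ring.
Qed.

Lemma Cexp_PI_odd (m : Z) :
  Cexp (RtoC (IZR (2 * m + 1)) * (RtoC PI * Ci))%C = (- RtoC 1)%C.
Proof.
rewrite plus_IZR, RtoC_plus, Cmult_plus_distr_r, Cexp_plus, Cexp_PI_even.
rewrite Cmult_1_l; pose proof (Cexp_PI_nat 1) as H; simpl in H.
rewrite H, <- RtoC_opp; f_equal; ring.
Qed.

(** * Powers with respect to a chosen logarithm *)

Lemma cpow_0_l (L : C -> C) (s : R) : s <> 0 -> cpow L (RtoC 0) s = RtoC 0.
Proof.
intros Hs; unfold cpow.
destruct (Ceq_dec _ _) as [_|H]; [|now destruct H].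
now destruct (Req_EM_T s 0).
Qed.

Lemma cpow_nonzero (L : C -> C) (z : C) (s : R) :
  z <> RtoC 0 -> cpow L z s = Cexp (RtoC s * L z)%C.
Proof. intros Hz; unfold cpow; now destruct (Ceq_dec z (RtoC 0)). Qed.

Lemma Cmod_cpow (L : C -> C) (z : C) (s : R) :
  z <> RtoC 0 -> Cmod (cpow L z s) = exp (s * Re (L z)).
Proof.
intros Hz; rewrite cpow_nonzero, Cmod_Cexp by assumption.
f_equal; simpl; unfold Re; ring.
Qed.

Lemma Cmod_log_branch (L : C -> C) (z : C) :
  log_branch L -> z <> RtoC 0 -> Cmod z = exp (Re (L z)).
Proof. intros HL Hz; now rewrite <- Cmod_Cexp, HL. Qed.

(** For nonzero [z], both [L (cpow L z s)] and [s * L z] are logarithms of [cpow L z s]. They may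
    differ, but the natural factor [k] hides the difference. *)
Lemma cpow_cpow_INR (L : C -> C) (z : C) (s : R) (k : nat) :
  log_branch L -> s <> 0 -> cpow L (cpow L z s) (INR k) = cpow L z (INR k * s).
Proof.
intros HL Hs; destruct (Ceq_dec z (RtoC 0)) as [->|Hz].
- rewrite (cpow_0_l L s Hs); unfold cpow.
  destruct (Ceq_dec _ _) as [_|H]; [|now destruct H].
  destruct (Req_EM_T (INR k) 0) as [->|Hk], (Req_EM_T _ 0) as [H|H]; try easy.
  + destruct H; ring.
  + apply Rmult_integral in H; tauto.
- rewrite (cpow_nonzero L z s), (cpow_nonzero L z _) by assumption.
  rewrite cpow_nonzero by apply Cexp_neq_0.
  rewrite RtoC_mult, <- Cmult_assoc; apply Cexp_INR_ext, HL, Cexp_neq_0.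
Qed.

(** * Complex series, handled componentwise *)

Lemma CSeries_ext (u v : nat -> C) :
  (forall n, u n = v n) -> CSeries u = CSeries v.
Proof.
intros H; unfold CSeries; f_equal; apply Series_ext; intros n; now rewrite H.
Qed.

Lemma CSeriesZ_ext (u v : Z -> C) :
  (forall m, u m = v m) -> CSeriesZ u = CSeriesZ v.
Proof. intros H; unfold CSeriesZ; f_equal; apply CSeries_ext; intros n; apply H. Qed.

Definition ex_CSeries (u : nat -> C) : Prop :=
  ex_series (fun n => Re (u n)) /\ ex_series (fun n => Im (u n)).

Lemma CSeries_incr_1 (u : nat -> C) :
  ex_CSeries u -> CSeries u = (u O + CSeries (fun n => u (S n)))%C.
Proof.
intros [Hre Him]; unfold CSeries, Cplus; simpl.
now rewrite (Series_incr_1 _ Hre), (Series_incr_1 _ Him).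
Qed.

Lemma CSeries_opp (u : nat -> C) : CSeries (fun n => (- u n)%C) = (- CSeries u)%C.
Proof. unfold CSeries, Copp; simpl; now rewrite <- !Series_opp. Qed.

(** The series is read as a power series at 1, where the splitting into even and odd powers is
    known. *)
Lemma Series_even_odd (u : nat -> R) :
  ex_series (fun n => u (2 * n)%nat) -> ex_series (fun n => u (2 * n + 1)%nat) ->
  Series u = Series (fun n => u (2 * n)%nat) + Series (fun n => u (2 * n + 1)%nat).
Proof.
assert (Hp : forall v : nat -> R, PSeries v 1 = Series v).
{ intros v; apply Series_ext; intros n; rewrite pow1; ring. }
assert (He : forall v : nat -> R, ex_series v -> ex_pseries v (1 ^ 2)).
{ intros v; apply ex_series_ext; intros n.
  rewrite pow1, pow_n_pow, pow1; unfold scal; simpl; unfold mult; simpl; ring. }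
intros H0 H1.
rewrite <- !Hp, PSeries_odd_even by auto.
rewrite pow1; ring.
Qed.

Lemma CSeries_even_odd (u : nat -> C) :
  ex_CSeries (fun n => u (2 * n)%nat) -> ex_CSeries (fun n => u (2 * n + 1)%nat) ->
  CSeries u = (CSeries (fun n => u (2 * n)%nat) + CSeries (fun n => u (2 * n + 1)%nat))%C.
Proof.
intros [Hre0 Him0] [Hre1 Him1]; unfold CSeries, Cplus; simpl.
f_equal; [now apply (Series_even_odd (fun n => Re (u n)))
         |now apply (Series_even_odd (fun n => Im (u n)))].
Qed.

(** * Exponential decay as a criterion for summability over the integers *)

Definition exp_decay (u : Z -> C) : Prop :=
  exists K, forall n : Z, Cmod (u n) <= K * exp (- Rabs (IZR n)).

(** Losing at most 1 in absolute value costs a factor [exp 1] in the constant. The condition on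
    [phi] covers the maps used below: [m - 1], [- (m + 1)], [2 * m] and [2 * m + 1]. *)
Lemma exp_decay_reindex (u : Z -> C) (phi : Z -> Z) :
  (forall m, (Z.abs m - 1 <= Z.abs (phi m))%Z) ->
  exp_decay u -> exp_decay (fun m => u (phi m)).
Proof.
intros Hphi [K HK]; exists (K * exp 1); intros n.
assert (HK0 : 0 <= K).
{ pose proof (HK 0%Z) as H; rewrite Rabs_R0, Ropp_0, exp_0 in H.
  pose proof (Cmod_ge_0 (u 0%Z)); lra. }
eapply Rle_trans; [apply HK|].
rewrite Rmult_assoc, <- exp_plus; apply Rmult_le_compat_l; [exact HK0|].
specialize (Hphi n); apply IZR_le in Hphi.
rewrite minus_IZR, !abs_IZR in Hphi.
destruct (Req_dec (- Rabs (IZR (phi n))) (1 + - Rabs (IZR n))) as [->|Hne]; [lra|].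
apply Rlt_le, exp_increasing; lra.
Qed.

Lemma ex_series_exp_decay (v : nat -> R) (K : R) :
  (forall n, Rabs (v n) <= K * exp (- INR n)) -> ex_series v.
Proof.
intros H; apply (ex_series_le v (fun n => K * exp (-1) ^ n)).
- intros n; replace (exp (-1) ^ n) with (exp (- INR n)); [apply H|].
  induction n as [|n IH]; [simpl; now rewrite Ropp_0, exp_0|].
  rewrite S_INR; replace (- (INR n + 1)) with (-1 + - INR n) by ring.
  now rewrite exp_plus, IH.
- apply (ex_series_scal_l (V := R_NormedModule) K (fun n => exp (-1) ^ n)), ex_series_geom.
  rewrite Rabs_pos_eq by apply Rlt_le, exp_pos.
  rewrite <- exp_0; apply exp_increasing; lra.
Qed.

Lemma ex_CSeries_exp_decay (u : nat -> C) (K : R) :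
  (forall n, Cmod (u n) <= K * exp (- INR n)) -> ex_CSeries u.
Proof.
intros H; split; apply ex_series_exp_decay with K; intros n;
  (eapply Rle_trans; [|apply H]); (eapply Rle_trans; [|apply Rmax_Cmod]);
  [apply Rmax_l|apply Rmax_r].
Qed.

Lemma exp_decay_ex_nonneg (u : Z -> C) :
  exp_decay u -> ex_CSeries (fun n => u (Z.of_nat n)).
Proof.
intros [K HK]; apply ex_CSeries_exp_decay with K; intros n.
rewrite <- (Rabs_pos_eq (INR n)), INR_IZR_INZ by apply pos_INR; apply HK.
Qed.

Lemma exp_decay_ex_neg (u : Z -> C) :
  exp_decay u -> ex_CSeries (fun n => u (- Z.of_nat (S n))%Z).
Proof.
intros Hu.
assert (H : exp_decay (fun m => u (- (m + 1))%Z)).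
{ apply (exp_decay_reindex u (fun m => - (m + 1))%Z); [lia|exact Hu]. }
apply exp_decay_ex_nonneg in H; destruct H as [H1 H2].
split; [revert H1|revert H2]; apply ex_series_ext; intros n; do 2 f_equal; lia.
Qed.

(** * Shifting and parity splitting of series over the integers *)

Lemma CSeriesZ_opp (u : Z -> C) : CSeriesZ (fun m => (- u m)%C) = (- CSeriesZ u)%C.
Proof.
unfold CSeriesZ; rewrite !(CSeries_opp (fun n => u _)); ring.
Qed.

(** The shift only moves the term [u (-1)] from the negative half to the nonnegative half. *)
Lemma CSeriesZ_pred (u : Z -> C) :
  exp_decay u -> CSeriesZ (fun m => u (m - 1)%Z) = CSeriesZ u.
Proof.
intros Hu; unfold CSeriesZ.
rewrite (CSeries_incr_1 (fun n => u (Z.of_nat n - 1)%Z)).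
- rewrite (CSeries_incr_1 (fun n => u (- Z.of_nat (S n))%Z)) by now apply exp_decay_ex_neg.
  rewrite (CSeries_ext (fun n => u (Z.of_nat (S n) - 1)%Z) (fun n => u (Z.of_nat n)))
    by (intros n; f_equal; lia).
  rewrite (CSeries_ext (fun n => u (- Z.of_nat (S n) - 1)%Z)
             (fun n => u (- Z.of_nat (S (S n)))%Z)) by (intros n; f_equal; lia).
  simpl (Z.of_nat 0 - 1)%Z; simpl (- Z.of_nat 1)%Z; ring.
- apply (exp_decay_ex_nonneg (fun m => u (m - 1)%Z)).
  apply (exp_decay_reindex u (fun m => m - 1)%Z); [lia|exact Hu].
Qed.

Lemma CSeriesZ_even_odd (u : Z -> C) :
  exp_decay u ->
  CSeriesZ u = (CSeriesZ (fun m => u (2 * m)%Z) + CSeriesZ (fun m => u (2 * m + 1)%Z))%C.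
Proof.
intros Hu.
assert (H0 : exp_decay (fun m => u (2 * m)%Z))
  by (apply (exp_decay_reindex u (fun m => 2 * m)%Z); [lia|exact Hu]).
assert (H1 : exp_decay (fun m => u (2 * m + 1)%Z))
  by (apply (exp_decay_reindex u (fun m => 2 * m + 1)%Z); [lia|exact Hu]).
assert (Hext : forall v w : nat -> C, (forall n, v n = w n) -> ex_CSeries v -> ex_CSeries w).
{ intros v w E [Hre Him]; split; [revert Hre|revert Him];
    apply ex_series_ext; intros n; now rewrite E. }
assert (E0 : forall n, u (2 * Z.of_nat n)%Z = u (Z.of_nat (2 * n))) by (intros n; f_equal; lia).
assert (E1 : forall n, u (2 * Z.of_nat n + 1)%Z = u (Z.of_nat (2 * n + 1)))
  by (intros n; f_equal; lia).
(* The negative half starts at -1, so parities swap there: even integers sit at odd positions, odd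
   integers at even positions. *)
assert (E2 : forall n, u (2 * - Z.of_nat (S n))%Z = u (- Z.of_nat (S (2 * n + 1)))%Z)
  by (intros n; f_equal; lia).
assert (E3 : forall n, u (2 * - Z.of_nat (S n) + 1)%Z = u (- Z.of_nat (S (2 * n)))%Z)
  by (intros n; f_equal; lia).
unfold CSeriesZ.
rewrite (CSeries_even_odd (fun n => u (Z.of_nat n))),
  (CSeries_even_odd (fun n => u (- Z.of_nat (S n))%Z)).
- rewrite (CSeries_ext _ _ E0), (CSeries_ext _ _ E1), (CSeries_ext _ _ E2),
    (CSeries_ext _ _ E3); ring.
- exact (Hext _ _ E3 (exp_decay_ex_neg _ H1)).
- exact (Hext _ _ E2 (exp_decay_ex_neg _ H0)).
- exact (Hext _ _ E0 (exp_decay_ex_nonneg _ H0)).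
- exact (Hext _ _ E1 (exp_decay_ex_nonneg _ H1)).
Qed.

(** The indices [2 * m + 1] and [2 * m - 1] both run through all odd integers, so every parity class
    is counted twice. *)
Lemma CSeriesZ_half_shifts (u : Z -> C) :
  exp_decay u ->
  (RtoC 2 * CSeriesZ (fun m => u (2 * m)%Z) + CSeriesZ (fun m => u (2 * m + 1)%Z)
     + CSeriesZ (fun m => u (2 * m - 1)%Z) = RtoC 2 * CSeriesZ u)%C.
Proof.
intros Hu.
assert (H1 : exp_decay (fun m => u (2 * m + 1)%Z))
  by (apply (exp_decay_reindex u (fun m => 2 * m + 1)%Z); [lia|exact Hu]).
assert (E : CSeriesZ (fun m => u (2 * m - 1)%Z) = CSeriesZ (fun m => u (2 * m + 1)%Z)).
{ rewrite <- (CSeriesZ_pred _ H1); apply CSeriesZ_ext; intros m; f_equal; lia. }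
rewrite (CSeriesZ_even_odd u Hu), E; ring.
Qed.

(** * The common general term and its decay *)

(** The term [g n] of the overview: with [t = n / 2] and [c = 2], the exponents
    [t * (t + 1 / c) / 2] and [t * (t - 1 / c) / 2] become these eighths. *)
Definition theta_term (La Lb : C -> C) (a b x : C) (n : Z) : C :=
  (cpow La a (IZR n * (IZR n + 1) / 8) * cpow Lb b (IZR n * (IZR n - 1) / 8)
   * Cexp (RtoC (IZR n) * (RtoC PI * Ci) * x))%C.

(** Serves the degenerate cases [a = 0] and [b = 0]. On the support, [exp (1 - |n|)] is at least 1,
    so the sum of the three moduli is a bound. *)
Lemma exp_decay_finite_support (u : Z -> C) :
  (forall n, u n <> RtoC 0 -> (Z.abs n <= 1)%Z) -> exp_decay u.
Proof.
intros Hu; exists ((Cmod (u 0%Z) + Cmod (u 1%Z) + Cmod (u (-1)%Z)) * exp 1); intros n.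
pose proof (Cmod_ge_0 (u 0%Z)); pose proof (Cmod_ge_0 (u 1%Z));
  pose proof (Cmod_ge_0 (u (-1)%Z)).
rewrite Rmult_assoc, <- exp_plus.
destruct (Ceq_dec (u n) (RtoC 0)) as [E|E].
- rewrite E, Cmod_0; apply Rmult_le_pos; [lra|apply Rlt_le, exp_pos].
- apply Hu in E.
  assert (Hn : Cmod (u n) <= Cmod (u 0%Z) + Cmod (u 1%Z) + Cmod (u (-1)%Z)).
  { assert (n = 0 \/ n = 1 \/ n = -1)%Z as [->|[->| ->]] by lia; lra. }
  apply IZR_le in E; rewrite abs_IZR in E.
  pose proof (exp_ineq1_le (1 + - Rabs (IZR n))).
  nra.
Qed.

(** For nonzero [a] and [b] the modulus of the term is the Gaussian [exp (- p * n ^ 2 + q * n)], and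
    [|ab| < 1] says exactly that [p > 0]. If [a] or [b] is 0, only the indices where its exponent
    vanishes can contribute. *)
Lemma exp_decay_theta_term (La Lb : C -> C) (a b x : C) :
  log_branch La -> log_branch Lb -> Cmod (a * b)%C < 1 ->
  exp_decay (theta_term La Lb a b x).
Proof.
intros HLa HLb Hab.
assert (Hz : forall k l : Z, (IZR k * IZR l / 8 = 0) -> k = 0%Z \/ l = 0%Z).
{ intros k l H; rewrite <- mult_IZR in H.
  assert (H' : IZR (k * l) = 0) by lra; apply eq_IZR in H'; lia. }
destruct (Ceq_dec a (RtoC 0)) as [->|Ha].
{ apply exp_decay_finite_support; intros n Hn.
  destruct (Req_EM_T (IZR n * (IZR n + 1) / 8) 0) as [E|E].
  - rewrite <- plus_IZR in E; apply Hz in E; lia.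
  - destruct Hn; unfold theta_term; rewrite cpow_0_l by assumption; ring. }
destruct (Ceq_dec b (RtoC 0)) as [->|Hb].
{ apply exp_decay_finite_support; intros n Hn.
  destruct (Req_EM_T (IZR n * (IZR n - 1) / 8) 0) as [E|E].
  - rewrite <- minus_IZR in E; apply Hz in E; lia.
  - destruct Hn; unfold theta_term; rewrite (cpow_0_l Lb) by assumption; ring. }
rewrite Cmod_mult, (Cmod_log_branch La a), (Cmod_log_branch Lb b), <- exp_plus in Hab
  by assumption.
rewrite <- exp_0 in Hab; apply exp_lt_inv in Hab.
set (p := - (Re (La a) + Re (Lb b)) / 8).
set (q := (Re (La a) - Re (Lb b)) / 8 - PI * Im x).
assert (Hp : 0 < p) by (unfold p; lra).
(* The inner constant is the maximum of [(|q| + 1) * y - p * y ^ 2], found by completing the square;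
   the extra 1 pays for the decay [exp (- |n|)]. *)
exists (exp ((Rabs q + 1) ^ 2 / (4 * p))); intros n.
replace (Cmod _) with (exp (- p * IZR n ^ 2 + q * IZR n)).
- rewrite <- exp_plus.
  assert (H : - p * IZR n ^ 2 + q * IZR n
              <= (Rabs q + 1) ^ 2 / (4 * p) + - Rabs (IZR n)).
  { set (y := Rabs (IZR n)).
    assert (Hsq : (Rabs q + 1) ^ 2 / (4 * p) - (Rabs q + 1) * y + p * y ^ 2
                  = p * (y - (Rabs q + 1) / (2 * p)) ^ 2) by (field; lra).
    assert (0 <= p * (y - (Rabs q + 1) / (2 * p)) ^ 2)
      by (apply Rmult_le_pos; [lra|apply pow2_ge_0]).
    assert (Hy : y ^ 2 = IZR n ^ 2) by apply pow2_abs.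
    pose proof (Rle_abs (q * IZR n)) as Hq; rewrite Rabs_mult in Hq; fold y in Hq.
    rewrite <- Hy; lra. }
  destruct H as [H| ->]; [apply Rlt_le, exp_increasing, H|lra].
- unfold theta_term; rewrite !Cmod_mult, !Cmod_cpow, Cmod_Cexp, <- !exp_plus by assumption.
  f_equal; unfold p, q; simpl; unfold Re, Im; field.
Qed.

(** * Both kinds of theta function as series of the common term *)

Lemma theta_half (La Lb : C -> C) (a b x : C) (alpha : R) (k : Z) :
  alpha = IZR k / 2 ->
  theta La Lb alpha 0 2 a b x
  = CSeriesZ (fun m => theta_term La Lb a b x (2 * m + k)).
Proof.
intros ->; apply CSeriesZ_ext; intros m; unfold theta_term; cbv zeta.
rewrite plus_IZR, mult_IZR.
f_equal; [f_equal; f_equal; field|f_equal].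
replace (2 * IZR m + IZR k) with (2 * (IZR m + IZR k / 2)) by field.
rewrite !RtoC_mult; ring.
Qed.

(** A product of two consecutive integers is even and nonnegative. Taken at [n - 1], this also
    covers [n * (n - 1) / 2]. *)
Lemma half_mul_succ_nat (n : Z) : exists k : nat, IZR n * (IZR n + 1) / 2 = INR k.
Proof.
exists (Z.to_nat (n * (n + 1) / 2)).
rewrite INR_IZR_INZ, Z2Nat.id by (apply Z.div_pos; nia).
assert (H : (n * (n + 1) = 2 * (n * (n + 1) / 2))%Z).
{ apply Z.div_exact; [lia|].
  rewrite Zmod_even, Z.even_mul, Z.even_add; now destruct (Z.even n). }
apply (f_equal IZR) in H; rewrite (mult_IZR 2), mult_IZR, plus_IZR in H; lra.
Qed.

(** With [c = 1] the exponents of the fourth roots are natural numbers, so the iterated powers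
    merge. The characteristic [beta] survives only as a separate exponential factor. *)
Lemma theta_quarter (La Lb : C -> C) (a b x : C) (beta : R) :
  log_branch La -> log_branch Lb ->
  theta La Lb 0 beta 1 (cpow La a (1 / 4)) (cpow Lb b (1 / 4)) (x / RtoC 2)%C
  = CSeriesZ (fun n => theta_term La Lb a b x n
                       * Cexp (RtoC (IZR n) * (RtoC (2 * PI) * Ci) * RtoC beta))%C.
Proof.
intros HLa HLb; apply CSeriesZ_ext; intros n; unfold theta_term; cbv zeta.
rewrite Rplus_0_r, Rdiv_1_r.
destruct (half_mul_succ_nat n) as [k Hk].
destruct (half_mul_succ_nat (n - 1)) as [l Hl]; rewrite minus_IZR in Hl.
replace (IZR n * (IZR n - 1) / 2) with (INR l) by (rewrite <- Hl; field).
rewrite Hk, !cpow_cpow_INR by (assumption || lra).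
replace (INR k * (1 / 4)) with (IZR n * (IZR n + 1) / 8) by lra.
replace (INR l * (1 / 4)) with (IZR n * (IZR n - 1) / 8) by lra.
rewrite <- (Cmult_assoc _ (Cexp _) (Cexp _)), <- Cexp_plus; do 2 f_equal.
rewrite !RtoC_mult; field.
Qed.

Theorem lemma3 :
  forall (La Lb : C -> C) (a b x : C),
    log_branch La -> log_branch Lb ->
    Cmod (a * b)%C < 1 ->
    (RtoC 2 * theta La Lb 0 0 2 a b x
       + theta La Lb (1 / 2) 0 2 a b x
       + theta La Lb (- 1 / 2) 0 2 a b x
     = RtoC 2 * theta La Lb 0 0 1 (cpow La a (1 / 4)) (cpow Lb b (1 / 4)) (x / RtoC 2))%C
    /\
    (RtoC 2 * theta La Lb 0 0 2 a b x
       - (theta La Lb (1 / 2) 0 2 a b x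
          + theta La Lb (- 1 / 2) 0 2 a b x)
     = theta La Lb 0 (1 / 2) 1 (cpow La a (1 / 4)) (cpow Lb b (1 / 4)) (x / RtoC 2)
       + theta La Lb 0 (- 1 / 2) 1 (cpow La a (1 / 4)) (cpow Lb b (1 / 4)) (x / RtoC 2))%C.
Proof.
intros La Lb a b x HLa HLb Hab.
set (g := theta_term La Lb a b x).
assert (Hg : exp_decay g) by now apply exp_decay_theta_term.
rewrite (theta_half _ _ _ _ _ 0 0), (theta_half _ _ _ _ _ (1 / 2) 1),
  (theta_half _ _ _ _ _ (- 1 / 2) (-1)) by lra.
fold g.
rewrite (CSeriesZ_ext (fun m => g (2 * m + 0)%Z) (fun m => g (2 * m)%Z))
  by (intros m; f_equal; lia).
change (fun m => g (2 * m + -1)%Z) with (fun m => g (2 * m - 1)%Z).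
rewrite !theta_quarter by assumption; fold g.
split.
- rewrite (CSeriesZ_half_shifts g Hg); f_equal; apply CSeriesZ_ext; intros n.
  now rewrite Cmult_0_r, Cexp_0, Cmult_1_r.
(* Here [h n] is [(-1)^n g n], the common term of both series on the right; its modulus is that of
   [g n]. *)
- set (h n := (g n * Cexp (RtoC (IZR n) * (RtoC PI * Ci)))%C).
  assert (Hh : exp_decay h).
  { destruct Hg as [K HK]; exists K; intros n; unfold h.
    rewrite Cmod_mult, Cmod_Cexp.
    replace (Re _) with 0 by (simpl; ring).
    rewrite exp_0, Rmult_1_r; apply HK. }
  rewrite (CSeriesZ_ext
             (fun n => g n * Cexp (RtoC (IZR n) * (RtoC (2 * PI) * Ci) * RtoC (1 / 2)))%C h).
  2:{ intros n; unfold h; do 2 f_equal.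
      rewrite RtoC_mult, RtoC_div by lra; field. }
  rewrite (CSeriesZ_ext
             (fun n => g n * Cexp (RtoC (IZR n) * (RtoC (2 * PI) * Ci) * RtoC (- 1 / 2)))%C h).
  (* The values -1/2 and 1/2 of [beta] differ by 1, which changes the factor by
     [exp (2 pi i n) = 1]. *)
  2:{ intros n; unfold h; f_equal.
      rewrite <- (Cmult_1_r (Cexp _)), <- (Cexp_2PI_int n), <- Cexp_plus; f_equal.
      replace (- 1 / 2) with (- (1 / 2)) by lra.
      rewrite RtoC_mult, RtoC_opp, RtoC_div by lra; field. }
  replace (CSeriesZ h + CSeriesZ h)%C with (RtoC 2 * CSeriesZ h)%C by ring.
  (* Splitting [h] by parity returns [g] on even indices and [- g] on odd ones, which produces the
     minus sign on the left. *)
  rewrite <- (CSeriesZ_half_shifts h Hh).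
  rewrite (CSeriesZ_ext (fun m => h (2 * m)%Z) (fun m => g (2 * m)%Z)).
  2:{ intros m; unfold h; rewrite Cexp_PI_even; ring. }
  rewrite (CSeriesZ_ext (fun m => h (2 * m + 1)%Z) (fun m => (- g (2 * m + 1)%Z)%C)).
  2:{ intros m; unfold h; rewrite Cexp_PI_odd; ring. }
  rewrite (CSeriesZ_ext (fun m => h (2 * m - 1)%Z) (fun m => (- g (2 * m - 1)%Z)%C)).
  2:{ intros m; unfold h; replace (2 * m - 1)%Z with (2 * (m - 1) + 1)%Z by lia.
      rewrite Cexp_PI_odd; ring. }
  rewrite (CSeriesZ_opp (fun m => g (2 * m + 1)%Z)),
    (CSeriesZ_opp (fun m => g (2 * m - 1)%Z)).
  ring.
Qed.
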